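(* Let $p$ be a prime number, and let $n,r$ be positive integers. Let $A$ be a finite $p^n$-torsion abelian group and let $H\le A$ be a subgroup of index $r$. Then there is a subgroup $H'\le H$ of index at most $r^{n^2+n}$ in $A$ such that $H'$ has a complement in $A$.
   Context: An abelian group $A$ is $m$-torsion if $mx=0$ for all $x\in A$. A subgroup $H'\le A$ has a complement in $A$ if there is a subgroup $K\le A$ with $K+H'=A$ and $K\cap H'=\{0\}$. *)

(* Defs.v *)
From mathcomp Require Import all_boot all_fingroup.
Set Implicit Arguments.
Unset Strict Implicit.
Unset Printing Implicit Defensive.

Local Open Scope group_scope.

(* Abelian groups are written multiplicatively: m x = 0 reads x ^+ m = 1. *)
Definition torsion (gT : finGroupType) (m : nat) (A : {group gT}) : Prop :=
  forall x : gT, x \in A -> x ^+ m = 1.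

(* Main.v *)
(** By induction on the index of H it suffices to split off one cyclic factor
    at a time: a subgroup M of prime index in an abelian group A contains a
    complement B of some cyclic <x> <= A.  Applied to a maximal M containing H
    this costs a factor at most p^n in the index of B, while the index of
    B :&: H in B is at most #|A : H| / p.  A direct factor of a direct factor is
    a direct factor, so this actually yields the stronger bound r^n. *)
Require Import Defs.
From mathcomp Require Import all_boot all_fingroup all_solvable.
Set Implicit Arguments.
Unset Strict Implicit.
Unset Printing Implicit Defensive.

Local Open Scope group_scope.

Lemma indexg_setI_leq (gT : finGroupType) (A B H : {group gT}) :
  B \subset A -> (#|B : B :&: H| <= #|A : H|)%N.
Proof.
by move=> sBA; rewrite indexgI; apply/subset_leq_card/imsetS.
Qed.

(* A cyclic factor <z> of maximal order has a complement C.  If C is not in M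
   then by induction C = D x <x> with D <= M, hence x is not in M and z can be
   corrected by a power of x to an element w of M; maximality of the order of z
   ensures #[w] <= #[z], so that D <w> is a complement of <x> in A. *)
Lemma prime_index_cyclic_compl (gT : finGroupType) (A M : {group gT}) :
    abelian A -> M \subset A -> prime #|A : M| ->
  exists B : {group gT}, exists x, B \subset M /\ B \x <[x]> = A.
Proof.
have [k] := ubnP #|A|; elim: k A M => // k IHk A M /ltnSE-leAk cAA sMA prM.
have nMA : M <| A by rewrite /normal sMA sub_abelian_norm.
have maxM : maximal M A by apply: p_index_maximal.
have [z Az oz] := exponent_witness (abelian_nil cAA).
have /splitsP[C /complP[tiZC defZC]] := abelian_splits Az (esym oz) cAA.
have sZA : <[z]> \subset A by rewrite cycle_subG.
have sCA : C \subset A by rewrite -defZC mulG_subr.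
have defA : <[z]> \x C = A by rewrite dprodE // (centSS sCA sZA).
have oA : (#[z] * #|C|)%N = #|A| by apply: dprod_card.
have [sCM | nsCM] := boolP (C \subset M).
  by exists C, z; rewrite dprodC.
(* As [M] is maximal and does not contain [C], [M * C = A]; hence [C :&: M] has the same index in
   [C] as [M] in [A]. *)
have prMC : prime #|C : C :&: M|.
  by rewrite indexgI -indexMg (mulg_normal_maximal nMA maxM).
(* If [z] were trivial, [A] would have exponent 1 and no subgroup of prime index. So [C] is strictly
   smaller than [A]. *)
have z_gt1 : (1 < #[z])%N.
  rewrite ltn_neqAle order_gt0 andbT eq_sym -dvdn1 -oz -trivg_exponent.
  apply: contraL prM => /eqP A1; suff /eqP-> : #|A : M| == 1%N by [].
  by rewrite indexg_eq1 A1 sub1G.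
have ltCk : (#|C| < k)%N by rewrite (leq_trans _ leAk) // -oA ltn_Pmull.
have [D [x [sDCM defC]]] :=
  IHk _ _ ltCk (abelianS sCA cAA) (subsetIl C M) prMC.
have /subsetIP[sDC sDM] := sDCM.
have [_ mulDx _ _] := dprodP defC.
have Cx : x \in C by rewrite -cycle_subG -mulDx mulG_subr.
have Ax := subsetP sCA x Cx.
have sXA : <[x]> \subset A by rewrite cycle_subG.
have nsXM : ~~ (<[x]> \subset M).
  by apply: contra nsCM => sXM; rewrite -mulDx mul_subG.
have /mulsgP[w y Mw Xy def_z] : z \in M * <[x]>.
  by rewrite (mulg_normal_maximal nMA maxM).
have Aw := subsetP sMA w Mw.
have sDWM : D <*> <[w]> \subset M by rewrite join_subG sDM cycle_subG.
exists (D <*> <[w]>)%G, x; split=> //=.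
have sDWA := subset_trans sDWM sMA.
have cDWX : <[x]> \subset 'C(D <*> <[w]>) by rewrite (centSS sXA sDWA).
have cDW : <[w]> \subset 'C(D).
  by rewrite (centSS _ (subset_trans sDM sMA) cAA) ?cycle_subG.
have defDWX : (D <*> <[w]>) * <[x]> = A.
  apply/eqP; rewrite -cent_joinEr // eqEsubset join_subG sDWA sXA /=.
  (* [E] contains [w] and [y], hence [z]; it contains [D] and [x], hence [C]. *)
  set E := (D <*> <[w]> <*> <[x]>)%G.
  have /joing_subP[sDWE sXE] : D <*> <[w]> <*> <[x]> \subset E by exact: subxx.
  have /joing_subP[sDE sWE] := sDWE.
  change (A \subset E); rewrite -defZC -mulDx !mul_subG // cycle_subG def_z groupM //.
    by rewrite -cycle_subG.
  exact: subsetP sXE _ Xy.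
have le_wz : (#[w] <= #[z])%N by rewrite -oz dvdn_leq ?exponent_gt0 ?dvdn_exponent.
(* Trivial intersection follows by counting: [#|D <*> <[w]>| * #[x]] is at most [#[z] * #|D| * #[x]
   = #[z] * #|C| = #|A|]. *)
apply: cprod_card_dprod; first by rewrite cprodE.
rewrite -oA -(dprod_card defC) mulnA leq_mul2r (cent_joinEr cDW).
have leDW : (#|(D * <[w]>)%g| <= #|D| * #[w])%N.
  by rewrite dvdn_leq ?dvdn_cardMg // muln_gt0 !cardG_gt0.
by rewrite (leq_trans leDW) ?orbT // mulnC leq_mul2r le_wz orbT.
Qed.

Lemma bounded_index_dprod (p n : nat) (gT : finGroupType) (A H : {group gT}) :
    prime p -> abelian A -> exponent A %| p ^ n -> H \subset A ->
  exists B : {group gT}, exists K : {group gT},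
    [/\ B \subset H, (#|A : B| <= #|A : H| ^ n)%N & B \x K = A].
Proof.
move=> p_pr; have [k] := ubnP #|A : H|.
elim: k A H => // k IHk A H /ltnSE-leAHk cAA expA sHA.
have pA : p.-group A.
  by rewrite -pnat_exponent; apply: pnat_dvd expA _; rewrite pnatX pnat_id.
have [-> | [M maxM sHM]] := maximal_exists sHA.
  by exists A, 1%G; rewrite indexgg exp1n dprodg1.
have sMA := proper_sub (maxgroupp maxM).
have iAM := p_maximal_index pA maxM.
have [|B [x [sBM defA]]] := prime_index_cyclic_compl cAA sMA; first by rewrite iAM.
have sBA := subset_trans sBM sMA.
have [_ mulBx _ _] := dprodP defA.
have Ax : x \in A by rewrite -cycle_subG -mulBx mulG_subr.
(* This index is [#[x]], which divides the exponent of [A]. *)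
have iAB : (#|A : B| <= p ^ n)%N.
  rewrite -divgS // -(dprod_card defA) mulKn ?cardG_gt0 //.
  by rewrite dvdn_leq ?expn_gt0 ?prime_gt0 // (dvdn_trans (dvdn_exponent Ax)).
have iBH : (#|B : B :&: H| <= #|M : H|)%N by apply: indexg_setI_leq.
have iAH : (p * #|M : H|)%N = #|A : H| by rewrite -iAM Lagrange_index.
have ltBHk : (#|B : B :&: H| < k)%N.
  apply: leq_ltn_trans iBH (leq_trans _ leAHk).
  by rewrite -iAH ltn_Pmull ?prime_gt1.
have [B' [K [sB'BH iBB' defB]]] := IHk _ _ ltBHk (abelianS sBA cAA)
  (dvdn_trans (exponentS sBA) expA) (subsetIl B H).
have /subsetIP[sB'B sB'H] := sB'BH.
(* Regrouping [(B' \x K) \x <[x]>] gives the complement [L = K \x <[x]>] of [B']. *)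
have := defA; rewrite -defB -dprodA => defA'.
have [[_ L _ defL] _ _ _] := dprodP defA'.
exists B', L; split=> //; last by rewrite -defL.
(* The factors [#|A : B|] and [#|B : B'|] are at most [p ^ n] and [#|M : H| ^ n], whose product is
   [#|A : H| ^ n]. *)
rewrite -(Lagrange_index sBA sB'B) -iAH expnMn leq_mul //.
rewrite (leq_trans iBB') //.
by have [-> // | n_gt0] := posnP n; rewrite leq_exp2r.
Qed.

Theorem proposition4p4 (p n r : nat) (gT : finGroupType) (A H : {group gT})
    (p_prime : prime p) (n_gt0 : (0 < n)%N) (r_gt0 : (0 < r)%N)
    (abelA : abelian A) (torsA : torsion (p ^ n)%N A)
    (sHA : H \subset A) (indexH : #|A : H| = r) :
  exists H' : {group gT},
    [/\ H' \subset H,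
        (#|A : H'| <= r ^ (n ^ 2 + n))%N
      & [splits A, over H']].
Proof.
have expA : exponent A %| p ^ n by apply/exponentP.
have [B [K [sBH iAB defA]]] := bounded_index_dprod p_prime abelA expA sHA.
exists B; split=> //.
  by rewrite (leq_trans iAB) // indexH leq_pexp2l // leq_addl.
by apply/splitsP; exists K; apply/sdprod_compl/dprodWsd.
Qed.
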